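(* Let $X$ be a Tychonoff space. If there exist a JN-sequence $\langle\mu_n\colon n\in\omega\rangle$ on $X$ and a number $M\in\omega$ such that $|\operatorname{supp}(\mu_n)|\le M$ for every $n\in\omega$, then $X$ admits a JN-sequence $\langle\nu_n\colon n\in\omega\rangle$ such that $|\operatorname{supp}(\nu_n)|=2$ for every $n\in\omega$. Consequently, there exist two disjoint sequences $\langle x_n\colon n\in\omega\rangle$ and $\langle y_n\colon n\in\omega\rangle$ of distinct points in $X$ (that is, the $x_n$ are pairwise distinct, the $y_n$ are pairwise distinct, and $\{x_n\colon n\in\omega\}\cap\{y_n\colon n\in\omega\}=\emptyset$) such that \[\lim_{n\to\infty}\big(f(x_n)-f(y_n)\big)=0\] for every $f\in C(X)$.
   Context: $C(X)$ is the set of all (not necessarily bounded) continuous functions $X\to\mathbb{R}$. A finitely supported (signed Borel) measure on $X$ is a finite linear combination $\mu=\sum_{x\in F}\alpha_x\delta_x$ of one-point (Dirac) measures, with $F\subseteq X$ finite and $\alpha_x\in\mathbb{R}\setminus\{0\}$ for $x\in F$; its support is $\operatorname{supp}(\mu)=F$, its norm is $\|\mu\|=\sum_{x\in F}|\alpha_x|$, and $\mu(f)=\int_X f\,d\mu=\sum_{x\in F}\alpha_xf(x)$. A JN-sequence on a Tychonoff space $X$ is a sequence $\langle\mu_n\colon n\in\omega\rangle$ of finitely supported signed measures on $X$ such that $\|\mu_n\|=1$ for every $n\in\omega$ and $\lim_{n\to\infty}\mu_n(f)=0$ for every $f\in C(X)$. *)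

(* Defs.v *)
From HB Require Import structures.
From mathcomp Require Import all_boot all_order all_algebra finmap.
From mathcomp Require Import boolp classical_sets functions reals topology.
From mathcomp Require Import normedtype sequences.
Set Implicit Arguments.
Unset Strict Implicit.
Unset Printing Implicit Defensive.
Import Order.TTheory GRing.Theory Num.Theory.
Import numFieldNormedType.Exports.
Local Open Scope classical_set_scope.
Local Open Scope ring_scope.

(* [uniform_separatorP] restates the separation required by
   [completely_regular_space] with continuous functions into [0, 1]. *)
Definition tychonoff_space (X : topologicalType) : Prop :=
  hausdorff_space X /\ completely_regular_space X.

(* The linear combination of Dirac measures with coefficients alpha_x is encoded
   by the function x |-> alpha_x, which vanishes outside a finite set.  Its
   support, the set of points with a nonzero coefficient, is [finsupp]. *)
Notation fsmeasure R X := {fsfun X -> R with 0%R}.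

Definition fsmeasure_norm (R : realType) (X : topologicalType)
    (mu : fsmeasure R X) : R :=
  \sum_(x <- finsupp mu) `|mu x|.

Definition fsmeasure_int (R : realType) (X : topologicalType)
    (mu : fsmeasure R X) (f : X -> R) : R :=
  \sum_(x <- finsupp mu) mu x * f x.

Definition JN_sequence (R : realType) (X : topologicalType)
    (mu : nat -> fsmeasure R X) : Prop :=
  (forall n, fsmeasure_norm (mu n) = 1) /\
  (forall f : X -> R, continuous f ->
     fsmeasure_int (mu n) f @[n --> \oo] --> (0 : R)).

(* Main.v *)
(** Pick an atom [z_n] of [mu_n] whose weight is bounded below.  If along some
    subsequence another atom [y_n] of [mu_n] satisfies [f (z_n) - f (y_n) --> 0]
    for every continuous [f], the measures [(delta_{z_n} - delta_{y_n}) / 2]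
    form a JN-sequence.  Otherwise the other atoms can be treated one at a time: some
    [f] keeps [f (z_n)] and [f (y_n)] at distance at least [e] along a
    subsequence, and Efremovich's lemma thins it out so that [f (z_n)] and
    [f (y_m)] are [e / 4] apart for all [n] and [m]; hence a continuous [g] is
    [1] at every [z_n] and [0] at every [y_n].  The product of these at most [M]
    functions integrates to [mu_n (z_n)], which does not tend to [0].

    The points of such a pair of sequences become distinct by thinning out,
    unless one of the two takes a value [p] infinitely often; the other one then
    converges to [p] without meeting it, so a subsequence of it is injective, and
    its even and odd terms form the required pair. *)

Require Import Defs.
From HB Require Import structures.
From mathcomp Require Import all_boot all_order all_algebra finmap.
From mathcomp Require Import boolp classical_sets functions reals topology.
From mathcomp Require Import normedtype sequences.
From mathcomp Require Import lra.
Import Order.TTheory GRing.Theory Num.Theory.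
Import numFieldNormedType.Exports.
Local Open Scope classical_set_scope.
Local Open Scope ring_scope.

(** * Extraction of subsequences *)

Lemma increasing_seq_cvg (phi : nat -> nat) :
  increasing_seq phi -> phi @ \oo --> \oo.
Proof.
move=> inc; apply/cvgnyPge => N; near=> n.
have phi_ge k : (k <= phi k)%N.
  elim: k => // k /leq_ltn_trans; apply.
  by move/increasing_seqP : inc; exact.
by apply: leq_trans (phi_ge n); near: n; exact: nbhs_infty_ge.
Unshelve. all: by end_near. Qed.

Lemma increasing_seq_comp (phi psi : nat -> nat) :
  increasing_seq phi -> increasing_seq psi -> increasing_seq (phi \o psi).
Proof. by move=> incphi incpsi i j; rewrite /= incphi -leEnat incpsi. Qed.

(** The first hypothesis says that [P] holds infinitely often. Indices are chosen greedily: after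
    [m], only the finitely many eventual conditions [Q l] with [l <= m] matter, and these hold
    together from some point on. *)
Lemma subseq_refine (P : nat -> Prop) (Q : nat -> nat -> Prop) :
  ~ (\forall n \near \oo, ~ P n) -> (forall m, \forall n \near \oo, Q m n) ->
  exists phi : nat -> nat, [/\ increasing_seq phi, forall k, P (phi k) &
    forall i j, (i < j)%N -> Q (phi i) (phi j)].
Proof.
move=> freqP evQ.
have evQle m : \forall n \near \oo, forall l, (l <= m)%N -> Q l n.
  elim: m => [|m IH]; near=> n.
    by move=> l; rewrite leqn0 => /eqP ->; near: n; exact: evQ.
  move=> l; rewrite leq_eqVlt => /predU1P[->|]; first by near: n; exact: evQ.
  by rewrite ltnS; move: l; near: n.
have /choice[g gP] : forall m, exists n,
    [/\ (m < n)%N, P n & forall l, (l <= m)%N -> Q l n].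
  move=> m; apply/not_existsP => no; apply: freqP; near=> n => Pn.
  apply: (no n); split=> //; near: n; first exact: nbhs_infty_gt.
  exact: evQle.
(* The iteration starts at [g 0], since [P] may fail at [0] itself. *)
pose phi k := iter k.+1 g 0%N.
have inc : increasing_seq phi.
  by apply/increasing_seqP => k; case: (gP (phi k)).
exists phi; split=> // [k|i [//|j] ij]; first by case: (gP (iter k g 0%N)).
by case: (gP (phi j)) => _ _; apply; rewrite -leEnat inc.
Unshelve. all: by end_near. Qed.

Lemma subseq_frequently (P : nat -> Prop) : ~ (\forall n \near \oo, ~ P n) ->
  exists2 phi : nat -> nat, increasing_seq phi & forall k, P (phi k).
Proof.
move=> /(@subseq_refine _ (fun _ _ => True))[m|phi [inc Pphi _]].
  exact: nearW.
by exists phi.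
Qed.

(** Efremovich's lemma on the real line. *)
Lemma subseq_dist_ge (R : realType) (u v : nat -> R) (e : R) : 0 < e ->
  (forall n, e <= `|u n - v n|) ->
  exists2 phi : nat -> nat, increasing_seq phi &
    forall i j, e / 4 <= `|u (phi i) - v (phi j)|.
Proof.
move=> e0.
(* If [a] is within [e / 4] of [p] infinitely often, then along those indices its values are less
   than [e / 2] apart, so replacing [a (phi j)] by [a (phi i)] costs less than half of the gap
   [e]. *)
have cluster_case (a b : nat -> R) p : (forall n, e <= `|a n - b n|) ->
    ~ (\forall n \near \oo, ~ (`|a n - p| < e / 4)) ->
    exists2 phi : nat -> nat, increasing_seq phi &
      forall i j, e / 4 <= `|a (phi i) - b (phi j)|.
  move=> ab /subseq_frequently[phi inc ap]; exists phi => // i j.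
  have := ler_distD (a (phi i)) (a (phi j)) (b (phi j)).
  have := ler_distD p (a (phi j)) (a (phi i)).
  have := ab (phi j); have := ap i; have := ap j.
  rewrite (distrC p); lra.
move=> uv.
have [[p up]|/forallNP ufar] :=
    pselect (exists p, ~ (\forall n \near \oo, ~ (`|u n - p| < e / 4))).
  exact: cluster_case up.
have [[p vp]|/forallNP vfar] :=
    pselect (exists p, ~ (\forall n \near \oo, ~ (`|v n - p| < e / 4))).
  have vu n : e <= `|v n - u n| by rewrite distrC.
  have [phi inc far] := cluster_case _ _ _ vu vp.
  by exists phi => // i j; rewrite distrC.
(* Now each sequence eventually stays [e / 4] away from any given point, in particular from the
   earlier terms of the other one. The diagonal case is the hypothesis [uv]. *)
have [||phi [inc _ far]] := @subseq_refine (fun=> True)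
    (fun m n => e / 4 <= `|u m - v n| /\ e / 4 <= `|u n - v m|).
- by move=> [N _ /(_ N (leqnn N))] /(_ I).
- move=> m; near=> n; split.
    rewrite distrC leNgt; apply/negP; near: n.
    exact: contrapT (vfar _).
  by rewrite leNgt; apply/negP; near: n; exact: contrapT (ufar _).
exists phi => // i j; have [ij|ji|->] := ltngtP i j.
- by have [] := far _ _ ij.
- by have [] := far _ _ ji.
- by have := uv (phi j); lra.
Unshelve. all: by end_near. Qed.

(** The entourage of pairs at distance less than [e] misses [A] times [B]. *)
Lemma dist_ge_uniform_separator (R : realType) (A B : set R) (e : R) : 0 < e ->
  (forall a b, A a -> B b -> e <= `|a - b|) -> uniform_separator A B.
Proof.
move=> e0 AB; apply: uniform_separatorW.
exists [set ab | ball ab.1 e ab.2]; first by rewrite -entourage_ballE; exists e.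
apply/disjoints_subset => -[a b] [/= Aa Bb]; rewrite -ball_normE /=.
by apply/negP; rewrite -leNgt AB.
Qed.

(** * Asymptotic pairs of sequences and separating functions *)

Section asymptotic.
Variables (R : realType) (X : topologicalType).
Implicit Types (x y z : nat -> X) (s : nat -> seq X).

Definition asymptotic x y := forall f : X -> R, continuous f ->
  f (x n) - f (y n) @[n --> \oo] --> (0 : R).

Lemma asymptotic_sym x y : asymptotic x y -> asymptotic y x.
Proof.
move=> xy f cf; rewrite -oppr0.
under eq_fun do rewrite -opprB.
exact: cvgN (xy f cf).
Qed.

Lemma asymptotic_subseq x y (phi : nat -> nat) : increasing_seq phi ->
  asymptotic x y -> asymptotic (x \o phi) (y \o phi).
Proof.
move=> inc xy f cf.
exact: cvg_comp _ _ (increasing_seq_cvg _ inc) (xy f cf).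
Qed.

Lemma separate_subseq x y : ~ asymptotic x y ->
  exists (phi : nat -> nat) (g : X -> R), [/\ increasing_seq phi, continuous g,
    forall k, g (x (phi k)) = 1 & forall k, g (y (phi k)) = 0].
Proof.
move=> /existsNP[f /not_implyP[cf nfxy]].
have [e e0 freq] : exists2 e : R, 0 < e &
    ~ (\forall n \near \oo, ~ (e <= `|f (x n) - f (y n)|)).
  apply: contra_notP nfxy => noe; apply/cvgr0Pnorm_lt => e e0.
  apply: contrapT => nnear; apply: noe; exists e => //.
  apply: contra_not nnear; apply: filterS => n.
  by move=> /negP; rewrite -ltNge.
have [phi incphi far] := subseq_frequently _ freq.
have [psi incpsi sep] := 
  subseq_dist_ge _ (f \o x \o phi) (f \o y \o phi) _ e0 far.
have e40 : 0 < e / 4 by rewrite divr_gt0.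
have : uniform_separator (range (f \o y \o phi \o psi))
    (range (f \o x \o phi \o psi)).
  apply: dist_ge_uniform_separator e40 _ => _ _ [i _ <-] [j _ <-].
  by rewrite distrC; exact: sep.
move=> /(@uniform_separatorP _ R)[h [ch _ h0 h1]].
exists (phi \o psi), (h \o f); split.
- exact: increasing_seq_comp.
- by move=> t; apply: continuous_comp; [exact: cf|exact: ch].
- by move=> k; apply: h1; exists (f (x (phi (psi k)))) => //; exists k.
- by move=> k; apply: h0; exists (f (y (phi (psi k)))) => //; exists k.
Qed.

(** Induction on [M], with the tails of the lists handled first. If the remaining lists are empty
    infinitely often, [g] already works; otherwise their heads form a sequence that is either
    asymptotic to [z] or separated from it by some [h], and then [h * g] works. *)
Lemma asymptotic_or_isolated z s (M : nat) : (forall n, (size (s n) <= M)%N) ->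
  (exists (phi : nat -> nat) y, [/\ increasing_seq phi,
     forall k, y k \in s (phi k) & asymptotic (z \o phi) y]) \/
  (exists (phi : nat -> nat) (g : X -> R), [/\ increasing_seq phi,
     continuous g, forall k, g (z (phi k)) = 1 &
     forall k w, w \in s (phi k) -> g w = 0]).
Proof.
elim: M s => [|M IH] s szs.
  right; exists id, (cst 1); split=> //; first by move=> ?; exact: cvg_cst.
  by move=> k w; move: (szs k); rewrite leqn0 size_eq0 => /eqP ->.
have szt n : (size (behead (s n)) <= M)%N.
  by rewrite size_behead; move: (szs n); case: (size (s n)).
have [[phi [y [inc ys zy]]]|[phi [g [incphi cg gz gs]]]] := IH _ szt.
  by left; exists phi, y; split=> // k; apply: mem_behead.
have [freq|/contrapT ev] :=
    pselect (~ (\forall k \near \oo, s (phi k) <> [::])).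
  have [|psi incpsi s0] := @subseq_frequently (fun k => s (phi k) = [::]).
    exact: freq.
  right; exists (phi \o psi), g; split=> //; first exact: increasing_seq_comp.
  - by move=> k; exact: gz.
  - by move=> k w /=; rewrite s0.
have [|psi incpsi sn0] := @subseq_frequently (fun k => s (phi k) <> [::]).
  by move=> ev'; have [N _ /(_ N (leqnn N))[]] := filterI ev ev'.
have inc := increasing_seq_comp _ _ incphi incpsi.
(* The default [z k] is never reached, because [sn0] makes these lists nonempty. *)
pose y k := head (z k) (s (phi (psi k))).
have sE k : s (phi (psi k)) = y k :: behead (s (phi (psi k))).
  by rewrite /y; case: (s (phi (psi k))) (sn0 k).
have [zy|/separate_subseq[chi [h [incchi ch hz hy]]]] :=
    pselect (asymptotic (z \o phi \o psi) y).
  left; exists (phi \o psi), y; split=> // k.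
  by rewrite /= sE mem_head.
right; exists (phi \o psi \o chi), (fun w => h w * g w); split.
- exact: increasing_seq_comp.
- by move=> t; apply: continuousM; [exact: ch|exact: cg].
- by move=> k; rewrite /= gz mulr1; exact: hz.
- move=> k w; rewrite /= sE inE => /predU1P[->|/gs ->]; last by rewrite mulr0.
  by rewrite hy mul0r.
Qed.

(** * From a JN-sequence to an asymptotic pair *)

(** Otherwise the norm would be at most [M / (M + 1)]; the successor keeps this below [1] and covers
    [M = 0]. *)
Lemma exists_heavy_atom (mu : fsmeasure R X) (M : nat) :
  fsmeasure_norm mu = 1 -> (#|` finsupp mu| <= M)%N ->
  exists z : X, M.+1%:R^-1 <= `|mu z|.
Proof.
move=> mu1 suppM; apply: contrapT => /forallNP light.
suff : fsmeasure_norm mu < 1 by rewrite mu1 ltxx.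
apply: (@le_lt_trans _ _ (\sum_(x <- finsupp mu) M.+1%:R^-1)).
  by apply: ler_sum => x _; rewrite leNgt; apply/negP => /ltW; exact: light.
rewrite big_const_seq count_predT iter_addr_0 -[_ *+ size _]mulr_natl.
by rewrite ltr_pdivrMr// mul1r ltr_nat ltnS.
Qed.

Lemma JN_asymptotic_pair (mu : nat -> fsmeasure R X) (M : nat) :
  JN_sequence mu -> (forall n, (#|` finsupp (mu n)| <= M)%N) ->
  exists x y, (forall n, x n != y n) /\ asymptotic x y.
Proof.
move=> [mu1 mu0] suppM.
have /choice[z zmu] n : exists z : X, M.+1%:R^-1 <= `|mu n z|.
  exact: exists_heavy_atom.
pose s n : seq X := rem (z n) (finsupp (mu n)).
have szs n : (size (s n) <= M)%N.
  apply: leq_trans (suppM n); exact: (size_subseq (rem_subseq _ _)).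
have mem_s n w : (w \in s n) = (w != z n) && (w \in finsupp (mu n)).
  by rewrite mem_rem_uniq ?fset_uniq.
have [[phi [y [inc ys zy]]]|[phi [g [inc cg gz gs]]]] :=
    asymptotic_or_isolated z s M szs.
  exists (z \o phi), y; split=> // k.
  by have := ys k; rewrite mem_s eq_sym => /andP[].
have intE k : fsmeasure_int (mu (phi k)) g = mu (phi k) (z (phi k)).
  rewrite /fsmeasure_int (bigD1_seq (z (phi k))) ?fset_uniq//=; last first.
    rewrite mem_finsupp -normr_gt0.
    by apply: lt_le_trans (zmu _); rewrite invr_gt0.
  rewrite gz mulr1 big_seq_cond big1 ?addr0// => w /andP[wsupp wz].
  by rewrite (gs k) ?mulr0// mem_s wz.
(* Convergence of the integrals of [g] to [0] contradicts the lower bound on the weights at [z]. *)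
have /cvgr0Pnorm_lt/(_ M.+1%:R^-1) := cvg_comp _ _ (increasing_seq_cvg _ inc)
  (mu0 g cg).
rewrite invr_gt0 ltr0n => /(_ isT)[N _ /(_ N (leqnn N))] /=.
by rewrite intE ltNge zmu.
Qed.

(** * From an asymptotic pair to a JN-sequence *)

(** For [a != b] this is half the difference of the Dirac measures at [a] and [b]. For [a = b] the
    second update overwrites the first. *)
Definition dipole (a b : X) : fsmeasure R X :=
  [fsfun [fsfun [fsfun] with a |-> 2^-1] with b |-> - 2^-1].

Lemma finsupp_dipole a b : a != b -> finsupp (dipole a b) = [fset b; a]%fset.
Proof.
move=> ab; rewrite /dipole !finsupp_with finsupp0 oppr_eq0 invr_eq0.
by rewrite pnatr_eq0/= fsetU0.
Qed.

Lemma big_dipole (F : X -> R) a b : a != b ->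
  \sum_(w <- finsupp (dipole a b)) F w = F a + F b.
Proof.
move=> ab; rewrite finsupp_dipole//.
by rewrite big_fsetU1 ?inE 1?eq_sym// big_seq_fset1 addrC.
Qed.

Lemma dipoleE a b : a != b -> dipole a b a = 2^-1 /\ dipole a b b = - 2^-1.
Proof. by move=> /negPf ab; rewrite /dipole !fsfun_withE !eqxx ab. Qed.

Lemma dipole_JN_sequence x y : (forall n, x n != y n) -> asymptotic x y ->
  JN_sequence (fun n => dipole (x n) (y n)).
Proof.
move=> neq xy; split=> [n|f cf].
  rewrite /fsmeasure_norm big_dipole//; have [-> ->] := dipoleE _ _ (neq n).
  by rewrite normrN ger0_norm ?invr_ge0//; lra.
rewrite (_ : (fun n => _) = (fun n => 2^-1 * (f (x n) - f (y n)))).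
  by rewrite -(mulr0 2^-1); apply: cvgMr; exact: xy.
apply/funext => n; rewrite /fsmeasure_int big_dipole//.
by have [-> ->] := dipoleE _ _ (neq n); rewrite mulrBr mulNr.
Qed.

(** * Making the points of an asymptotic pair distinct *)

Lemma tychonoff_separates_points (a b : X) : tychonoff_space X -> a != b ->
  exists2 f : X -> R, continuous f & f a != f b.
Proof.
move=> [hX crX] ab.
have closedb : closed [set b].
  exact/accessible_closed_set1/hausdorff_accessible.
have : ~ [set b] a by move=> /= eab; rewrite eab eqxx in ab.
move=> /(crX _ _ closedb) /(@uniform_separatorP _ R)[f [cf _ f0 f1]].
exists f => //; rewrite (f0 (f a)); last by exists a.
by rewrite (f1 (f b)) 1?eq_sym ?oner_eq0//; exists b.
Qed.

Lemma disjoint_asymptotic_of_limit p y : tychonoff_space X ->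
  (forall n, y n != p) -> asymptotic y (cst p) ->
  exists x' y', [/\ injective x', injective y', range x' `&` range y' = set0 &
    asymptotic x' y'].
Proof.
move=> tX yp cvgp.
have [||phi [inc _ dist]] := @subseq_refine (fun=> True)
  (fun m n => y n != y m).
- by move=> [N _ /(_ N (leqnn N))] /(_ I).
(* Since [f (y n)] tends to [f p], which differs from [f (y m)], the value [y m] is eventually
   avoided. *)
- move=> m; have [f cf fneq] := tychonoff_separates_points _ _ tX (yp m).
  have /cvgr0Pnorm_lt/(_ `|f (y m) - f p|) := cvgp f cf.
  rewrite normr_gt0 subr_eq0 => /(_ fneq); apply: filterS => n.
  by apply: contraPneq => ->; rewrite ltxx.
have injyphi : injective (y \o phi).
  move=> i j /= /eqP; have [ij|ij|//] := ltngtP i j.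
    by rewrite eq_sym (negPf (dist _ _ ij)).
  by rewrite (negPf (dist _ _ ij)).
exists (fun n => y (phi n.*2)), (fun n => y (phi n.*2.+1)); split.
- by move=> i j /injyphi/double_inj.
- by move=> i j /injyphi[]/double_inj.
- apply/disjoints_subset => _ [i _ <-] [j _ /injyphi/(congr1 odd)].
  by rewrite /= !odd_double.
- move=> f cf.
  have inc_even : increasing_seq double.
    by move=> i j; rewrite !leEnat leq_double.
  have inc_odd : increasing_seq (S \o double).
    by move=> i j; rewrite !leEnat/= ltnS leq_double.
  have cve := asymptotic_subseq _ _ _ (increasing_seq_comp _ _ inc inc_even)
    cvgp f cf.
  have cvo := asymptotic_subseq _ _ _ (increasing_seq_comp _ _ inc inc_odd)
    cvgp f cf.
  rewrite -(subrr 0) (_ : (fun n => _) = (fun n => f (y (phi n.*2)) - f p) -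
      (fun n => f (y (phi n.*2.+1)) - f p)); first exact: cvgB cve cvo.
  by apply/funext => n; rewrite fctE opprB addrA subrK.
Qed.

Lemma disjoint_asymptotic_pair x y : tychonoff_space X ->
  (forall n, x n != y n) -> asymptotic x y ->
  exists x' y', [/\ injective x', injective y', range x' `&` range y' = set0 &
    asymptotic x' y'].
Proof.
move=> tX.
have limit_case p u v : ~ (\forall n \near \oo, ~ (u n = p)) ->
    (forall n, u n != v n) -> asymptotic u v ->
    exists x' y', [/\ injective x', injective y',
      range x' `&` range y' = set0 & asymptotic x' y'].
  move=> /subseq_frequently[phi inc uphi] neq uv.
  apply: (disjoint_asymptotic_of_limit p (v \o phi) tX) => [n|].
    by rewrite /= -(uphi n) eq_sym.
  have /asymptotic_sym := asymptotic_subseq _ _ _ inc uv.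
  by rewrite (_ : u \o phi = cst p)//; apply/funext.
move=> neq xy.
have [[p px]|/forallNP xev] :=
    pselect (exists p, ~ (\forall n \near \oo, ~ (x n = p))).
  exact: limit_case px neq xy.
have [[p py]|/forallNP yev] :=
    pselect (exists p, ~ (\forall n \near \oo, ~ (y n = p))).
  apply: limit_case py _ (asymptotic_sym _ _ xy) => n.
  by rewrite eq_sym.
(* No value recurs infinitely often in [x] or in [y], so later terms can avoid all earlier ones of
   both sequences; [neq] settles equal indices. *)
have [||phi [inc _ dist]] := @subseq_refine (fun=> True) (fun m n =>
    [/\ x n <> x m, x n <> y m, y n <> x m & y n <> y m]).
- by move=> [N _ /(_ N (leqnn N))] /(_ I).
- move=> m; near=> n; split; near: n.
  + exact: contrapT (xev _).
  + exact: contrapT (xev _).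
  + exact: contrapT (yev _).
  + exact: contrapT (yev _).
exists (x \o phi), (y \o phi); split.
- by move=> i j /= e; have [/dist[]|/dist[]|//] := ltngtP i j; rewrite e.
- by move=> i j /= e; have [/dist[]|/dist[]|//] := ltngtP i j; rewrite e.
- apply/disjoints_subset => _ [i _ <-] [j _ /= e].
  have [/dist[]|/dist[]|ij] := ltngtP i j; rewrite ?e//.
  by move: (neq (phi i)); rewrite -e ij eqxx.
- exact: asymptotic_subseq.
Unshelve. all: by end_near. Qed.

End asymptotic.

Theorem theorem1p4 (R : realType) (X : topologicalType) :
  tychonoff_space X ->
  (exists (mu : nat -> fsmeasure R X) (M : nat),
     JN_sequence mu /\ forall n, (#|` finsupp (mu n)| <= M)%N) ->
  (exists nu : nat -> fsmeasure R X,
     JN_sequence nu /\ forall n, #|` finsupp (nu n)| = 2%N) /\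
  (exists x y : nat -> X,
     [/\ injective x, injective y, range x `&` range y = set0 &
       forall f : X -> R, continuous f ->
         f (x n) - f (y n) @[n --> \oo] --> (0 : R)]).
Proof.
move=> tX [mu [M [JNmu suppM]]].
have [x [y [neq xy]]] := JN_asymptotic_pair _ _ _ _ JNmu suppM.
split; last exact: disjoint_asymptotic_pair tX neq xy.
exists (fun n => dipole R X (x n) (y n)).
split; first exact: dipole_JN_sequence.
by move=> n; rewrite finsupp_dipole// cardfs2 eq_sym neq.
Qed.
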